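(* Let $k\ge 1$ and, for $t\ge 2$, let $\mathcal{G}_t^{gr}$ be the Grassmann algebra $\langle 1,e_1,\dots,e_t\mid e_ie_j=-e_je_i\rangle$ with the grading whose even (odd) part is spanned by monomials in the $e_i$ of even (odd) length. Then: (1) $c_n^{gr,z}(\mathcal{G}_{2k}^{gr})=c_n^{gr,z}(\mathcal{G}_{2k+1}^{gr})=\sum_{1\le i\le 2k,\ i\text{ odd}}\binom{n}{i}$; (2) $\delta_n^{gr}(\mathcal{G}_{2k}^{gr})=\sum_{0\le i\le 2k,\ i\text{ even}}\binom{n}{i}$ and $\delta_n^{gr}(\mathcal{G}_{2k+1}^{gr})=\binom{n}{2k+1}+\delta_n^{gr}(\mathcal{G}_{2k}^{gr})$; (3) $\chi_n^{gr,z}(\mathcal{G}_{2k}^{gr})=\chi_n^{gr,z}(\mathcal{G}_{2k+1}^{gr})=\sum_{1\le i\le 2k,\ i\text{ odd}}\chi_{(n-i),(1^i)}$; (4) $\chi_n(\Delta^{gr}(\mathcal{G}_{2k}^{gr}))=\sum_{0\le i\le 2k,\ i\text{ even}}\chi_{(n-i),(1^i)}$ and $\chi_n(\Delta^{gr}(\mathcal{G}_{2k+1}^{gr}))=\chi_{(n-2k-1),(1^{2k+1})}+\sum_{0\le i\le 2k,\ i\text{ even}}\chi_{(n-i),(1^i)}$.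
   Context: $F$ is a field of characteristic zero. A superalgebra is an algebra $A=A_0\oplus A_1$ with $A_iA_j\subseteq A_{i+j\bmod 2}$; $Z(A)$ is the center. $F\langle Y,Z\rangle$ is the free algebra on even variables $y_1,y_2,\dots$ and odd variables $z_1,z_2,\dots$. $\mathrm{Id}^{gr}(A)$ is the set of graded identities; $C^{gr}(A)$ is the set of central graded polynomials (zero constant term, all evaluations with even variables in $A_0$ and odd in $A_1$ lie in $Z(A)$). $P_n^{gr}$ is the span of monomials $w_{\sigma(1)}\cdots w_{\sigma(n)}$, $\sigma\in S_n$, $w_i\in\{y_i,z_i\}$; $c_n^{gr,z}(A)=\dim P_n^{gr}/(P_n^{gr}\cap C^{gr}(A))$, $\delta_n^{gr}(A)=\dim(P_n^{gr}\cap C^{gr}(A))/(P_n^{gr}\cap\mathrm{Id}^{gr}(A))$. $\mathbb{Z}_2\wr S_n$ acts on $P_n^{gr}$ by $(a_1,\dots,a_n;\sigma)y_i=y_{\sigma(i)}$, $(a_1,\dots,a_n;\sigma)z_i=a_{\sigma(i)}z_{\sigma(i)}$ ($a_j=\pm1$); $\chi_n^{gr,z}(A)$ and $\chi_n(\Delta^{gr}(A))$ denote the characters of $P_n^{gr}/(P_n^{gr}\cap C^{gr}(A))$ and $(P_n^{gr}\cap C^{gr}(A))/(P_n^{gr}\cap\mathrm{Id}^{gr}(A))$. $\chi_{\lambda,\mu}$ is the irreducible $\mathbb{Z}_2\wr S_n$-character indexed by $\lambda\vdash n-r$ (even variables) and $\mu\vdash r$ (odd variables); $1^i$ denotes the partition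 with $i$ parts equal to $1$. *)

(* Defs.v *)
From HB Require Import structures.
From mathcomp Require Import all_boot all_order all_fingroup all_algebra.
From Stdlib Require Import ClassicalEpsilon.
Set Implicit Arguments. Unset Strict Implicit. Unset Printing Implicit Defensive.
Import Order.TTheory GRing.Theory.
Local Open Scope ring_scope.

Section Grassmann.
Variables (F : fieldType) (t : nat).

(* The Grassmann algebra G_t = <1, e_1..e_t | e_i e_j = - e_j e_i>, an element
   is the family of its coordinates on the monomials e_S = e_{s1}...e_{sm}
   (s1 < ... < sm), S ranging over the subsets of 'I_t. *)
Definition Gr := {ffun {set 'I_t} -> F}.

(* sign of e_A e_B = gsign A B e_(A :|: B) for disjoint A, B *)
Definition gsign (A B : {set 'I_t}) : F :=
  (-1) ^+ #|[set p : 'I_t * 'I_t | (p.1 \in A) && (p.2 \in B) && (p.2 < p.1)%N]|.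

Definition gmul (u v : Gr) : Gr :=
  [ffun S : {set 'I_t} => \sum_(A : {set 'I_t}) \sum_(B : {set 'I_t} | (A :|: B == S) && [disjoint A & B])
               gsign A B * u A * v B].

Definition gone : Gr := [ffun S : {set 'I_t} => (S == set0)%:R].

Definition gr_even (u : Gr) : Prop := forall S : {set 'I_t}, odd #|S| -> u S = 0.
Definition gr_odd (u : Gr) : Prop := forall S : {set 'I_t}, ~~ odd #|S| -> u S = 0.

Definition gr_central (u : Gr) : Prop := forall x, gmul u x = gmul x u.

End Grassmann.

Section Polys.
Variables (F : fieldType) (n : nat).

(* Index of the monomials of P_n^gr : (Z, pi) stands for the monomial
   w_(pi 0) w_(pi 1) ... w_(pi (n-1)), where w_i = z_i if i \in Z, y_i otherwise. *)
Definition Idx := ({set 'I_n} * {perm 'I_n})%type.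

Definition Pn := {ffun Idx -> F^o}.

Definition monomial_eval (t : nat) (k : Idx) (a b : 'I_n -> Gr F t) : Gr F t :=
  foldr (@gmul F t) (gone F t)
    [seq (if k.2 j \in k.1 then b (k.2 j) else a (k.2 j)) | j <- enum 'I_n].

Definition poly_eval (t : nat) (f : Pn) (a b : 'I_n -> Gr F t) : Gr F t :=
  [ffun S : {set 'I_t} => \sum_(k : Idx) f k * monomial_eval k a b S].

Definition graded_assign (t : nat) (a b : 'I_n -> Gr F t) : Prop :=
  (forall i, gr_even (a i)) /\ (forall i, gr_odd (b i)).

(* f in P_n^gr is a central graded polynomial of G_t^gr (n >= 1 so the
   constant term is automatically zero) *)
Definition central_poly (t : nat) (f : Pn) : Prop :=
  forall a b : 'I_n -> Gr F t, graded_assign a b -> gr_central (poly_eval f a b).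

Definition identity_poly (t : nat) (f : Pn) : Prop :=
  forall a b : 'I_n -> Gr F t, graded_assign a b -> poly_eval f a b = 0.

(* the subspace of Pn consisting of the vectors satisfying P (when P defines a
   subspace, which is the case for central_poly and identity_poly) *)
Definition vspace_of (P : Pn -> Prop) : {vspace Pn} :=
  epsilon (inhabits 0%VS) (fun U : {vspace Pn} => forall v, v \in U <-> P v).

Definition PC t := vspace_of (central_poly t).
Definition PId t := vspace_of (identity_poly t).

Definition cgrz t : nat := (\dim (fullv : {vspace Pn}) - \dim (PC t))%N.
Definition deltagr t : nat := (\dim (PC t) - \dim (PId t))%N.

(* ---- the wreath product Z_2 wr S_n ----
   (a; sigma) with a : 'I_n -> bool (true standing for -1). *)
Definition W := ({ffun 'I_n -> bool} * {perm 'I_n})%type.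

Definition bsign (b : bool) : F := if b then -1 else 1.

(* action on P_n^gr:  (a;s) y_i = y_(s i),  (a;s) z_i = a_(s i) z_(s i); hence
   (a;s) maps the monomial (Z, pi) to (prod_(j in s Z) a_j) (s Z, s o pi). *)
Definition act (g : W) (f : Pn) : Pn :=
  [ffun k : Idx => (\prod_(j in k.1) bsign (g.1 j)) *
     f ((g.2^-1)%g @: k.1, (k.2 * (g.2^-1))%g)].

Definition trace_on (U : {vspace Pn}) (h : Pn -> Pn) : F :=
  \sum_(i < \dim U) coord (vbasis U) i (h (tnth (vbasis U) i)).

(* chi_n^{gr,z}(G_t): character of P_n / (P_n /\ C) *)
Definition chigrz t (g : W) : F := trace_on fullv (act g) - trace_on (PC t) (act g).
(* chi_n(Delta^gr(G_t)): character of (P_n /\ C) / (P_n /\ Id) *)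
Definition chiDelta t (g : W) : F := trace_on (PC t) (act g) - trace_on (PId t) (act g).

(* group law of Z_2 wr S_n compatible with act (act (mulW g h) = act g o act h) *)
Definition mulW (g h : W) : W :=
  ([ffun j => g.1 j (+) h.1 ((g.2^-1)%g j)], (h.2 * g.2)%g).
Definition invW (g : W) : W := ([ffun j => g.1 (g.2 j)], (g.2^-1)%g).

(* the irreducible character chi_{(n-r),(1^r)}:  induced from the stabiliser
   Z_2 wr S_(n-r) x Z_2 wr S_r of the set Z0 of the last r indices, of the
   linear character (trivial) (x) (sign of Z_2 on each factor times sgn of S_r),
   i.e. the outer tensor product of chi_(n-r) on the even variables and
   chi_(1^r) on the odd variables. *)
Definition Z0 (r : nat) : {set 'I_n} := [set j : 'I_n | (n - r <= j)%N].
Definition stabZ0 r (g : W) : bool := g.2 @: Z0 r == Z0 r.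
Definition phi_hook r (g : W) : F :=
  (\prod_(j in Z0 r) bsign (g.1 j)) *
  (-1) ^+ #|[set p : 'I_n * 'I_n | [&& p.1 \in Z0 r, p.2 \in Z0 r,
                                      (p.1 < p.2)%N & (g.2 p.2 < g.2 p.1)%N]]|.

Definition chi_hook (r : nat) (g : W) : F :=
  if (r <= n)%N then
    ((2 ^ n * (n - r)`! * r`!)%:R)^-1 *
      \sum_(x : W | stabZ0 r (mulW (invW x) (mulW g x))) phi_hook r (mulW (invW x) (mulW g x))
  else 0.

End Polys.

(* Main.v *)
Require Import Defs.
From HB Require Import structures.
From mathcomp Require Import all_boot all_order all_fingroup all_algebra.
From mathcomp Require Import ring zify.
From Stdlib Require Import ClassicalEpsilon.
Import GRing.Theory.
Local Open Scope ring_scope.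

(* By supercommutativity, on a graded assignment the monomial (Z, pi) equals
   eps(Z, pi) times the ordered monomial (Z, 1), where eps is the inversion sign
   of pi on the odd letters. Hence f evaluates to the sum over Z of c_Z(f) times
   the value of (Z, 1), with c_Z(f) = sum_pi eps(Z, pi) f(Z, pi), and that value
   lives in degrees >= #|Z| of the parity of #|Z|. Since an assignment can isolate
   any Z with #|Z| <= t, the identities are given by c_Z = 0 for all #|Z| <= t and
   the central polynomials by c_Z = 0 for all odd #|Z| < t. The wreath product
   permutes the functionals c_Z up to sign, so traces on these subspaces are
   obtained by subtracting the signed fixed points of g on the sets Z, which
   level by level are the values of the induced characters chi_((n-i),(1^i)).
   Dimensions are the traces of the identity. *)

Set Implicit Arguments. Unset Strict Implicit. Unset Printing Implicit Defensive.

(** * The Grassmann algebra: associativity, supercommutativity, degrees *)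

Section GrassmannAlgebra.
Variables (F : fieldType) (t : nat).
Implicit Types (A B C S : {set 'I_t}) (u v w : Gr F t).

(** The exponent of [gsign] as a double sum, which makes it additive in each argument over disjoint
    unions. *)
Definition ninv A B : nat := \sum_(a in A) \sum_(b in B) (b < a)%N.

Lemma gsignE A B : gsign F A B = (-1) ^+ ninv A B.
Proof.
rewrite /gsign /ninv; congr (_ ^+ _); rewrite -sum1dep_card.
rewrite pair_big /= big_mkcond [RHS]big_mkcond /=.
by apply: eq_bigr => -[a b] _ /=; case: (a \in A); case: (b \in B); case: (b < a)%N.
Qed.

Lemma ninvUl A B C : [disjoint A & B] -> ninv (A :|: B) C = (ninv A C + ninv B C)%N.
Proof. by move=> dAB; rewrite /ninv -bigU //; apply: eq_bigl => x; rewrite !inE. Qed.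

Lemma ninvUr A B C : [disjoint B & C] -> ninv A (B :|: C) = (ninv A B + ninv A C)%N.
Proof.
move=> dBC; rewrite /ninv -big_split; apply: eq_bigr => a _.
by rewrite -bigU //; apply: eq_bigl => x; rewrite !inE.
Qed.

(** By disjointness a differs from b, so each pair is an inversion in exactly one of the two
    orders. *)
Lemma ninvC A B : [disjoint A & B] -> (ninv A B + ninv B A = #|A| * #|B|)%N.
Proof.
move=> dAB; rewrite /ninv [X in (_ + X)%N]exchange_big -big_split /=.
rewrite (eq_bigr (fun=> #|B|)) ?sum_nat_const // => a aA.
rewrite -big_split -sum1_card; apply: eq_bigr => b bB /=.
have : a != b :> nat by apply: contraTneq bB => /val_inj <-; rewrite (disjointFr dAB).
by case: ltngtP.
Qed.

Lemma gsignC A B : [disjoint A & B] -> gsign F A B = (-1) ^+ (#|A| * #|B|) * gsign F B A.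
Proof. by move=> /ninvC <-; rewrite !gsignE exprD -mulrA -expr2 sqrr_sign mulr1. Qed.

Lemma gsign_neq0 A B : gsign F A B != 0.
Proof. by rewrite gsignE signr_eq0. Qed.

(** Both exponents are the sum of the inversions between A and B, A and C, B and C. Associativity of
    [gmul] reduces to this identity. *)
Lemma gsign_cocycle A B C :
    [disjoint A & B] -> [disjoint B & C] ->
  gsign F A B * gsign F (A :|: B) C = gsign F A (B :|: C) * gsign F B C.
Proof. by move=> dAB dBC; rewrite !gsignE ninvUl // ninvUr // !exprD; ring. Qed.

Lemma gmulE u v S :
  gmul u v S = \sum_(A : {set _} | A \subset S) gsign F A (S :\: A) * u A * v (S :\: A).
Proof.
rewrite ffunE [RHS]big_mkcond; apply: eq_bigr => A _.
case: ifPn => [AS | nAS]; last first.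
  rewrite big_pred0 // => B; apply: contraNF nAS => /andP[/eqP<- _]; exact: subsetUl.
rewrite (big_pred1 (S :\: A)) // => B /=.
apply/andP/eqP => [[/eqP<- dAB] | ->]; last first.
  by rewrite -{1}(setIidPr AS) setID eqxx disjoints_subset setCD subsetUr.
by rewrite setDUl setDv set0U; apply/esym/setDidPl; rewrite disjoint_sym.
Qed.

Lemma gmulA : associative (@gmul F t).
Proof.
move=> u v w; apply/ffunP => S; rewrite !gmulE.
under [RHS]eq_bigr => D _.
  rewrite gmulE mulr_sumr mulr_suml; over.
rewrite (exchange_big_dep (fun A => A \subset S)) /=; last first.
  by move=> D A DS AD; apply: subset_trans AD DS.
apply: eq_bigr => A AS; rewrite gmulE mulr_sumr.
(* Both sides run over ordered splittings of S into three blocks; D is the union of the first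
   two. *)
rewrite [RHS](reindex_onto (fun B => A :|: B) (fun D => D :\: A)) /=; last first.
  by move=> D /andP[_ AD]; rewrite -{1}(setIidPr AD) setID.
apply: eq_big => [B | B BSA].
  rewrite subsetUl andbT subUset AS subsetD /=; case: (B \subset S) => //=.
  rewrite setDUl setDv set0U; apply/idP/eqP => [/setDidPl //| <-].
  by rewrite disjoint_sym disjoints_subset setCD subsetUr.
have dAB : [disjoint A & B].
  by rewrite disjoint_sym; move: BSA; rewrite subsetD => /andP[].
have -> : (A :|: B) :\: A = B.
  by rewrite setDUl setDv set0U; apply/setDidPl; rewrite disjoint_sym.
rewrite -setDDl; set C := S :\: A :\: B.
have dBC : [disjoint B & C] by rewrite disjoints_subset setCD subsetUr.
have -> : S :\: A = B :|: C by rewrite -{1}(setIidPr BSA) setID.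
have := gsign_cocycle dAB dBC; move: (gsign F A B) => a E.
transitivity (gsign F A (B :|: C) * gsign F B C * u A * v B * w C); first by ring.
by rewrite -E; ring.
Qed.

Lemma gmul1g : left_id (gone F t) (@gmul F t).
Proof.
move=> u; apply/ffunP => S; rewrite gmulE (bigD1 set0) ?sub0set //= big1 => [|A /andP[_ nA]].
  by rewrite ffunE eqxx setD0 gsignE /ninv big_set0 expr0 !mul1r addr0.
by rewrite ffunE (negbTE nA) mulr0 mul0r.
Qed.

Lemma gmulg1 : right_id (gone F t) (@gmul F t).
Proof.
move=> u; apply/ffunP => S; rewrite gmulE (bigD1 S) ?subxx //= big1 => [|A /andP[AS nA]].
  rewrite ffunE setDv eqxx gsignE /ninv big1 ?expr0 ?mul1r ?mulr1 ?addr0 // => a _.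
  by rewrite big_set0.
rewrite ffunE (_ : _ == _ = false) ?mulr0 // setD_eq0; apply: contraNF nA => SA.
by rewrite eqEsubset AS.
Qed.

HB.instance Definition _ := Monoid.isLaw.Build (Gr F t) (gone F t) (@gmul F t) gmulA gmul1g gmulg1.

Lemma gmul0g v : gmul 0 v = 0.
Proof. by apply/ffunP=> S; rewrite gmulE big1 ?ffunE // => A _; rewrite ffunE mulr0 mul0r. Qed.

Lemma gmulg0 v : gmul v 0 = 0.
Proof. by apply/ffunP=> S; rewrite gmulE big1 ?ffunE // => A _; rewrite ffunE mulr0. Qed.

Definition gscale (c : F) u : Gr F t := [ffun S => c * u S].

Lemma gscale1 u : gscale 1 u = u.
Proof. by apply/ffunP => S; rewrite ffunE mul1r. Qed.

Lemma gscaleA c d u : gscale c (gscale d u) = gscale (c * d) u.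
Proof. by apply/ffunP => S; rewrite !ffunE mulrA. Qed.

Lemma gmulZl c u v : gmul (gscale c u) v = gscale c (gmul u v).
Proof.
apply/ffunP => S; rewrite [RHS]ffunE !gmulE mulr_sumr.
by apply: eq_bigr => A _; rewrite ffunE; ring.
Qed.

Lemma gmulZr c u v : gmul u (gscale c v) = gscale c (gmul u v).
Proof.
apply/ffunP => S; rewrite [RHS]ffunE !gmulE mulr_sumr.
by apply: eq_bigr => A _; rewrite ffunE; ring.
Qed.

(** All contributing pairs have the same swap sign, which therefore factors out. Restricting to
    disjoint pairs in the supports lets this serve both for sorting letters and for centrality. *)
Lemma gmul_comm_sign (e : nat) u v :
    (forall A B, [disjoint A & B] -> u A != 0 -> v B != 0 -> odd (#|A| * #|B|) = odd e) ->
  gmul u v = gscale ((-1) ^+ e) (gmul v u).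
Proof.
move=> uv; apply/ffunP => S; rewrite !ffunE (exchange_big_dep predT) //= mulr_sumr.
apply: eq_bigr => B _; rewrite mulr_sumr.
apply: eq_big => [A|A /andP[_ dAB]]; first by rewrite setUC disjoint_sym.
have [->|uA] := eqVneq (u A) 0; first by rewrite !(mulr0, mul0r).
have [->|vB] := eqVneq (v B) 0; first by rewrite !(mulr0, mul0r).
by rewrite gsignC // -signr_odd uv // signr_odd; ring.
Qed.

(** A lower bound on the degrees together with their parity: both add up under products. *)
Definition supp_deg d u :=
  forall S, u S != 0 -> (d <= #|S|)%N /\ odd #|S| = odd d.

Lemma supp_deg_even u : gr_even u -> supp_deg 0 u.
Proof.
by move=> eu S; case: (boolP (odd #|S|)) => [/eu -> | /negbTE//]; rewrite eqxx.
Qed.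

Lemma supp_deg_odd u : gr_odd u -> supp_deg 1 u.
Proof.
move=> eu S; case: (boolP (odd #|S|)) => [oS _ | /eu ->]; last by rewrite eqxx.
by split=> //; case: #|S| oS.
Qed.

Lemma supp_deg_gone : supp_deg 0 (gone F t).
Proof. by move=> S; rewrite ffunE; have [->|] := eqVneq S set0; rewrite ?cards0 ?eqxx. Qed.

Lemma supp_deg_gmul d e u v : supp_deg d u -> supp_deg e v -> supp_deg (d + e) (gmul u v).
Proof.
move=> su sv S nz.
have /existsP [A /andP[AS]] : [exists A : {set _}, (A \subset S) && (u A * v (S :\: A) != 0)].
  apply: contraNT nz => /existsPn H; rewrite gmulE big1 // => A AS; rewrite -mulrA.
  by move: (H A); rewrite AS negbK => /eqP ->; rewrite mulr0.
rewrite mulf_eq0 negb_or => /andP[/su[dA oA] /sv[eB oB]].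
by rewrite -(cardsID A S) (setIidPr AS) leq_add // !oddD oA oB.
Qed.

Definition gbasis S : Gr F t := [ffun S' => (S' == S)%:R].

Lemma gmul_basis A B : [disjoint A & B] ->
  gmul (gbasis A) (gbasis B) = gscale (gsign F A B) (gbasis (A :|: B)).
Proof.
move=> dAB; apply/ffunP => S; rewrite !ffunE (bigD1 A) //= [X in _ + X]big1 ?addr0; last first.
  by move=> A' nA; apply: big1 => B' _; rewrite ffunE (negbTE nA) mulr0 mul0r.
rewrite big_mkcond (bigD1 B) //= big1 ?addr0 => [|B' nB].
  by rewrite dAB andbT eq_sym; case: eqP => // _; rewrite ?mulr0 // !ffunE !eqxx !mulr1.
by case: ifP => // _; rewrite !ffunE (negbTE nB) mulr0.
Qed.

(** Injectivity of [r] keeps each new generator disjoint from the product already formed, so every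
    factor entering [c] is a [gsign], hence nonzero. *)
Lemma big_gmul_odd_basis (I : eqType) (s : seq I) (r : I -> 'I_t) :
    uniq s -> {in s &, injective r} ->
  exists2 c : F, c != 0 &
    \big[@gmul F t/gone F t]_(i <- s) gbasis [set r i] =
      gscale c (gbasis [set x | x \in map r s]).
Proof.
elim: s => [_ _ | x s IH /= /andP[xs us] injr].
  exists 1; rewrite ?oner_eq0 // big_nil gscale1; apply/ffunP => S; rewrite !ffunE.
  by congr (_ == _)%:R; apply/setP => x; rewrite !inE.
have injs : {in s &, injective r}.
  by move=> i j si sj; apply: injr; rewrite inE ?si ?sj orbT.
have [c c0 E] := IH us injs.
have dj : [disjoint [set r x] & [set y | y \in map r s]].
  rewrite disjoints1 inE; apply: contra xs => /mapP[y ys rxy].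
  by rewrite (injr x y) // inE ?ys ?eqxx ?orbT.
exists (c * gsign F [set r x] [set y | y \in map r s]).
  by rewrite mulf_neq0 ?gsign_neq0.
rewrite big_cons E gmulZr gmul_basis // gscaleA; congr (gscale _ (gbasis _)).
by apply/setP => y; rewrite !inE.
Qed.

(** Some generator lies outside S and anticommutes with the odd monomial on S; comparing
    coefficients of their product gives 2c = 0. *)
Lemma gbasis_noncentral (char2 : (2%:R : F) != 0) (c : F) S :
  odd #|S| -> (#|S| < t)%N -> gr_central (gscale c (gbasis S)) -> c = 0.
Proof.
move=> oS lt cen; have /set0Pn[x] : ~: S != set0.
  by rewrite -card_gt0 cardsCs setCK card_ord subn_gt0.
rewrite inE => xS; have dj : [disjoint S & [set x]].
  by rewrite disjoint_sym disjoints1.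
have dj' : [disjoint [set x] & S] by rewrite disjoint_sym.
have := cen (gbasis [set x]); rewrite gmulZl gmulZr !gmul_basis //.
rewrite setUC (gsignC dj) cards1 muln1 -signr_odd oS expr1 mulN1r.
move=> /ffunP/(_ ([set x] :|: S)); rewrite !ffunE eqxx !mulr1 => /eqP.
rewrite mulrN -subr_eq0 -opprD oppr_eq0 -mulr2n -mulr_natl !mulf_eq0.
by rewrite (negbTE char2) (negbTE (gsign_neq0 _ _)) orbF => /eqP.
Qed.

End GrassmannAlgebra.

(** * Inversion signs of permutations restricted to a subset *)

Section InversionSign.
Variables (F : fieldType) (n : nat).
Implicit Types (A Z : {set 'I_n}) (s u : {perm 'I_n}).

(* The sign part of phi_hook, for an arbitrary set instead of Z0 r. *)
Definition inv_sign A s : F :=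
  (-1) ^+ #|[set p : 'I_n * 'I_n | [&& p.1 \in A, p.2 \in A,
                                      (p.1 < p.2)%N & (s p.2 < s p.1)%N]]|.

Lemma inv_signE A s :
  inv_sign A s = \prod_(p : 'I_n * 'I_n | [&& p.1 \in A, p.2 \in A & (p.1 < p.2)%N])
                   (-1) ^+ (s p.2 < s p.1)%N.
Proof.
rewrite /inv_sign -prodr_const big_mkcond [RHS]big_mkcond /=.
apply: eq_bigr => p _; rewrite inE.
by case: (p.1 \in A); case: (p.2 \in A); case: (p.1 < p.2)%N; case: (s p.2 < s p.1)%N.
Qed.

Lemma inv_sign1 A : inv_sign A 1 = 1.
Proof.
by rewrite inv_signE big1 // => p /and3P[_ _ lt]; rewrite !perm1 ltnNge ltnW.
Qed.

(** Each unordered pair of distinct elements of A occurs once on either side; only its orientation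
    differs, and [phi] is symmetric. *)
Lemma prod_increasing_pairs A s (phi : 'I_n -> 'I_n -> F) :
    (forall x y, phi x y = phi y x) ->
  \prod_(p : 'I_n * 'I_n | [&& p.1 \in A, p.2 \in A & (p.1 < p.2)%N]) phi p.1 p.2 =
  \prod_(p : 'I_n * 'I_n | [&& p.1 \in A, p.2 \in A & (s p.1 < s p.2)%N]) phi p.1 p.2.
Proof.
move=> phiC; rewrite (bigID (fun p : 'I_n * 'I_n => (s p.1 < s p.2)%N)) /=.
rewrite [RHS](bigID (fun p : 'I_n * 'I_n => (p.1 < p.2)%N)) /=.
congr (_ * _); first by apply: eq_bigl => p; rewrite -!andbA; do !bool_congr.
(* What remains are the pairs whose order [s] reverses; the two sides list them with opposite
   orientations. *)
have swapK : involutive (fun p : 'I_n * 'I_n => (p.2, p.1)) by case.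
rewrite (reindex_inj (inv_inj swapK)) /=; apply: eq_big => [[x y]|[x y] _] //=.
case: (eqVneq x y) => [->|xy]; first by rewrite !ltnn !andbF.
have nxy : x != y :> nat by [].
have sxy : s x != s y :> nat by rewrite (inj_eq val_inj) (inj_eq perm_inj).
rewrite -!leqNgt [(s x <= _)%N]leq_eqVlt [(y <= x)%N]leq_eqVlt (negbTE sxy).
by rewrite eq_sym (negbTE nxy) /=; case: (x \in A); case: (y \in A) => //=; rewrite andbC.
Qed.

(* The sign discrepancy phi x y between s * u and s depends only on the unordered
   pair {x, y}, so its product over pairs of A can be reindexed along s. *)
Lemma inv_signM A s u : inv_sign A (s * u) = inv_sign A s * inv_sign (s @: A) u.
Proof.
pose sg (v : {perm 'I_n}) x y : F := (-1) ^+ (v y < v x)%N.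
pose phi x y := sg 1%g x y * sg u x y.
have sgN v x y : x != y -> sg v y x = - sg v x y.
  move=> xy; have : v x != v y :> nat by rewrite (inj_eq val_inj) (inj_eq perm_inj).
  by rewrite /sg; case: ltngtP => // _ _; rewrite ?expr0 ?expr1 ?opprK.
have phiC x y : phi x y = phi y x.
  case: (eqVneq x y) => [->//|xy].
  by rewrite /phi [sg 1%g y x]sgN // [sg u y x]sgN // mulrNN.
rewrite !inv_signE.
transitivity (\prod_(p : 'I_n * 'I_n | [&& p.1 \in A, p.2 \in A & (p.1 < p.2)%N])
   ((-1) ^+ (s p.2 < s p.1)%N * phi (s p.1) (s p.2))).
  apply: eq_bigr => p _; rewrite /phi /sg !perm1 !permM mulrA -expr2 sqrr_sign.
  by rewrite mul1r.
rewrite big_split /=; congr (_ * _).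
rewrite (prod_increasing_pairs _ s (fun x y => phiC (s x) (s y))).
pose h (p : 'I_n * 'I_n) := (s p.1, s p.2).
have hI : injective h by move=> [x y] [x' y'] [/perm_inj -> /perm_inj ->].
rewrite [RHS](reindex_inj hI) /=; apply: eq_big => [p|p /and3P[_ _ lt]].
  by rewrite !(mem_imset _ _ (@perm_inj _ s)).
by rewrite /phi /sg !perm1 [(s p.2 < s p.1)%N]ltnNge (ltnW lt) mul1r.
Qed.

End InversionSign.

(** * Sorting monomials and the functionals c_Z *)

Section MonomialSign.
Variables (F : fieldType) (n : nat).

(** Position j carries the letter of index [k.2 j], so the preimage of [k.1] is the set of positions
    of odd letters. *)
Definition mon_sign (k : Idx n) : F := inv_sign F (k.2 @^-1: k.1) k.2.

Section Sorting.
Variables (t : nat) (Z : {set 'I_n}) (w : 'I_n -> Gr F t).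
Hypothesis wC : forall i j,
  gmul (w i) (w j) = gscale ((-1) ^+ ((i \in Z) && (j \in Z))) (gmul (w j) (w i)).

Local Notation M s := (\big[@gmul F t/gone F t]_(i <- s) w i).

Lemma gmul_move x l :
  gmul (w x) (M l) =
    gscale ((-1) ^+ count (fun y => (x \in Z) && (y \in Z)) l) (gmul (M l) (w x)).
Proof.
elim: l => [|y l IH]; first by rewrite big_nil gmulg1 gmul1g gscale1.
by rewrite !big_cons gmulA wC gmulZl -gmulA IH gmulZr gmulA gscaleA -exprD.
Qed.

Fixpoint list_inv (s : seq 'I_n) : nat :=
  if s is x :: s' then
    count (fun y => [&& x \in Z, y \in Z & (y < x)%N]) s' + list_inv s'
  else 0.

(** Insertion sort: the head x enters the sorted product of the tail by passing the block [l1] of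
    smaller letters, at the cost of one sign per odd letter passed if x is odd. *)
Lemma gmul_sort s l :
    perm_eq s l -> sorted (fun i j : 'I_n => (i < j)%N) l ->
  M s = gscale ((-1) ^+ list_inv s) (M l).
Proof.
have tr : transitive (fun i j : 'I_n => (i < j)%N) by move=> ? ? ?; apply: ltn_trans.
elim: s l => [|x s IH] l ps sl.
  by move: ps; rewrite perm_sym => /perm_nilP ->; rewrite big_nil gscale1.
have xl : x \in l by rewrite -(perm_mem ps) mem_head.
case/splitPr: xl ps sl => l1 l2 ps sl.
have {}ps : perm_eq s (l1 ++ l2).
  by rewrite -(perm_cons x) (perm_trans ps) // perm_catC /= perm_cons perm_catC.
have sl' : sorted (fun i j : 'I_n => (i < j)%N) (l1 ++ l2).
  by apply: subseq_sorted sl => //; rewrite cat_subseq // subseq_cons.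
rewrite /= big_cons (IH _ ps sl') gmulZr !big_cat big_cons /= gmulA gmul_move.
rewrite gmulZl gscaleA -!gmulA -exprD addnC; congr (gscale (_ ^+ (_ + _)) _).
(* Entries of [l1] are below x and all count as inversions when odd; those of [l2] are above x and
   count for nothing. *)
rewrite (seq.permP ps) count_cat -[LHS]addn0; congr (_ + _)%N.
  apply: eq_in_count => y yl1; congr (_ && _).
  move: sl; rewrite sorted_pairwise // pairwise_cat => /and3P[/allrelP H _ _].
  by rewrite (H y x) ?andbT // mem_head.
rewrite (eq_in_count (a2 := pred0)) ?count_pred0 // => y yl2.
move: sl; rewrite sorted_pairwise // pairwise_cat /= => /and4P[_ _ /allP/(_ y yl2) xy _].
by rewrite ltnNge ltnW ?andbF.
Qed.

End Sorting.

(** As [s] is increasing, standing later in [s] means being larger, so list inversions become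
    inversions of [p]. *)
Lemma list_inv_map (Z : {set 'I_n}) (p : {perm 'I_n}) (s : seq 'I_n) :
    sorted (fun i j : 'I_n => (i < j)%N) s ->
  list_inv Z (map p s) =
    (\sum_(i <- s) \sum_(j <- s)
       [&& p i \in Z, p j \in Z, (i < j)%N & (p j < p i)%N])%N.
Proof.
have tr : transitive (fun i j : 'I_n => (i < j)%N) by move=> ? ? ?; apply: ltn_trans.
elim: s => [|x s IH] sx; first by rewrite big_nil.
have {}IH := IH (path_sorted sx).
have {sx} xs : {in s, forall y : 'I_n, (x < y)%N}.
  by apply/allP; move: sx; rewrite /= path_sortedE // => /andP[].
rewrite /= !big_cons ltnn !andbF add0n IH; congr (_ + _)%N.
  rewrite count_map -sum1_count big_mkcond big_seq [RHS]big_seq /=.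
  by apply: eq_bigr => y /xs ->; case: ifP.
rewrite big_seq [RHS]big_seq; apply: eq_bigr => y /xs lt.
by rewrite big_cons [(y < x)%N]ltnNge ltnW // !andbF.
Qed.

Lemma sorted_enum_ord : sorted (fun i j : 'I_n => (i < j)%N) (enum 'I_n).
Proof.
by have := iota_ltn_sorted 0 n; rewrite -val_enum_ord sorted_map.
Qed.

Definition letter t (Z : {set 'I_n}) (a b : 'I_n -> Gr F t) j :=
  if j \in Z then b j else a j.

Lemma monomial_evalE t k (a b : 'I_n -> Gr F t) :
  monomial_eval k a b =
    \big[@gmul F t/gone F t]_(j <- enum 'I_n) letter k.1 a b (k.2 j).
Proof. by rewrite /monomial_eval foldrE big_map. Qed.

Lemma letter_supp t (Z : {set 'I_n}) (a b : 'I_n -> Gr F t) j :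
  graded_assign a b -> supp_deg (j \in Z) (letter Z a b j).
Proof.
move=> [ea ob]; rewrite /letter.
by case: ifP => _; [apply: supp_deg_odd | apply: supp_deg_even].
Qed.

Lemma monomial_eval_sort t k (a b : 'I_n -> Gr F t) : graded_assign a b ->
  monomial_eval k a b = gscale (mon_sign k) (monomial_eval (k.1, 1%g) a b).
Proof.
move=> ab; rewrite !monomial_evalE -(big_map k.2 predT) /=.
have wC i j : gmul (letter k.1 a b i) (letter k.1 a b j) =
    gscale ((-1) ^+ ((i \in k.1) && (j \in k.1)))
      (gmul (letter k.1 a b j) (letter k.1 a b i)).
  apply: gmul_comm_sign => A B _ /(letter_supp ab)[_ oA] /(letter_supp ab)[_ oB].
  by rewrite oddM oA oB !oddb.
rewrite (gmul_sort wC (l := enum 'I_n)) ?sorted_enum_ord //; last first.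
  apply: uniq_perm; rewrite ?enum_uniq // ?(map_inj_uniq perm_inj) ?enum_uniq // => x.
  by rewrite mem_enum; apply/mapP; exists (k.2^-1%g x); rewrite ?mem_enum ?permKV.
congr (gscale _ _); last by apply: eq_bigr => i _; rewrite perm1.
rewrite list_inv_map ?sorted_enum_ord // /mon_sign /inv_sign; congr (_ ^+ _).
rewrite -sum1dep_card [RHS]big_mkcond /=.
transitivity (\sum_(i : 'I_n) \sum_(j : 'I_n)
       [&& k.2 i \in k.1, k.2 j \in k.1, (i < j)%N & (k.2 j < k.2 i)%N])%N.
  by rewrite big_enum; apply: eq_bigr => i _; rewrite big_enum.
by rewrite pair_big; apply: eq_bigr => p _; rewrite !inE; case: ifP.
Qed.

Lemma monomial_eval_supp t (k : Idx n) (a b : 'I_n -> Gr F t) : graded_assign a b ->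
  supp_deg #|k.1| (monomial_eval k a b).
Proof.
move=> ab; have -> : #|k.1| = (\sum_(j <- enum 'I_n) (k.2 j \in k.1))%N.
  rewrite big_enum -sum1_card big_mkcond (reindex_inj (@perm_inj _ k.2)) /=.
  by apply: eq_bigr => i _; case: ifP.
rewrite monomial_evalE; elim: (enum _) => [|j s IH].
  by rewrite !big_nil; apply: supp_deg_gone.
by rewrite !big_cons; apply: supp_deg_gmul IH; apply: letter_supp.
Qed.

(** The functional c_Z: the coefficient of the ordered monomial (Z, 1) once all monomials are
    sorted. *)
Definition sorted_coef (Z : {set 'I_n}) (f : Pn F n) : F :=
  \sum_(p : {perm 'I_n}) mon_sign (Z, p) * f (Z, p).

Lemma poly_evalE t (f : Pn F n) (a b : 'I_n -> Gr F t) S : graded_assign a b ->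
  poly_eval f a b S =
    \sum_(Z : {set 'I_n}) sorted_coef Z f * monomial_eval (Z, 1%g) a b S.
Proof.
move=> ab; rewrite ffunE.
under [RHS]eq_bigr do rewrite mulr_suml.
rewrite pair_big /=; apply: eq_bigr => -[Z p] _ /=.
by rewrite monomial_eval_sort // ffunE /=; ring.
Qed.

(** After translating the summation variable by [g.2], [inv_signM] splits the sign into that of p,
    which rebuilds the functional at the preimage of Z, and a constant one from [g.2]. *)
Lemma sorted_coef_act (g : W n) (f : Pn F n) (Z : {set 'I_n}) :
  sorted_coef Z (Defs.act g f) =
    (\prod_(j in Z) bsign F (g.1 j)) * inv_sign F (g.2^-1%g @: Z) g.2 *
      sorted_coef (g.2^-1%g @: Z) f.
Proof.
rewrite /sorted_coef (reindex_inj (mulIg g.2)) mulr_sumr; apply: eq_bigr => p _ /=.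
rewrite ffunE /= mulgK /mon_sign /= inv_signM.
have -> : p @: ((p * g.2)%g @^-1: Z) = g.2^-1%g @: Z.
  apply/setP => x; rewrite -[x](permKV p) (mem_imset _ _ (@perm_inj _ p)) inE permM.
  by rewrite -[in RHS](permK g.2 (p _)) (mem_imset _ _ (@perm_inj _ _)).
have -> : (p * g.2)%g @^-1: Z = p @^-1: (g.2^-1%g @: Z).
  apply/setP => x; rewrite !inE permM.
  by rewrite -[in RHS](permK g.2 (p _)) (mem_imset _ _ (@perm_inj _ _)).
by ring.
Qed.

(* Dual to the functionals sorted_coef. *)
Definition sec_basis (Z : {set 'I_n}) : Pn F n := [ffun k => (k == (Z, 1%g))%:R].

Lemma sorted_coef_sec (Z Z' : {set 'I_n}) : sorted_coef Z' (sec_basis Z) = (Z' == Z)%:R.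
Proof.
rewrite /sorted_coef (bigD1 1%g) //= big1 ?addr0 => [|p np].
  by rewrite ffunE /mon_sign inv_sign1 mul1r xpair_eqE eqxx andbT.
by rewrite ffunE xpair_eqE (negbTE np) andbF mulr0.
Qed.

End MonomialSign.

(** * Counting permutations that carry one subset to another *)

Section PermutationsBetweenSubsets.
Variable n : nat.
Implicit Types (A B : {set 'I_n}).

(** List A followed by its complement, likewise B, and match the two lists entry by entry. *)
Lemma perm_imset_exists A B : #|A| = #|B| -> exists p : {perm 'I_n}, p @: A = B.
Proof.
move=> cAB; pose s (C : {set 'I_n}) := enum C ++ enum (~: C).
have s_all C x : x \in s C by rewrite mem_cat !mem_enum inE orbN.
have s_uniq C : uniq (s C).
  rewrite cat_uniq !enum_uniq andbT /=; apply/hasPn => x.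
  by rewrite !mem_enum inE.
have s_size C : size (s C) = n by rewrite size_cat -!cardE cardsC card_ord.
have s_idx C D x : (index x (s C) < size (s D))%N.
  by rewrite s_size -[X in (_ < X)%N](s_size C) index_mem.
(* The default x is never reached, both lists having length n; it is a convenient one because ['I_n]
   may be empty. *)
have injf : injective (fun x => nth x (s B) (index x (s A))).
  move=> x y; rewrite (set_nth_default y) //.
  move/eqP; rewrite nth_uniq // => /eqP E.
  by rewrite -(nth_index x (s_all A x)) E nth_index.
exists (perm injf); apply/eqP; rewrite eqEcard card_imset; last exact: perm_inj.
rewrite cAB leqnn andbT; apply/subsetP => _ /imsetP[x xA ->].
rewrite permE index_cat mem_enum xA nth_cat -cardE -cAB cardE index_mem mem_enum xA.
by rewrite -mem_enum mem_nth // -cardE -cAB cardE index_mem mem_enum.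
Qed.

(** Translation by a permutation from B to C shows that the count is the same for every target of
    size [#|A|]. These targets partition the n! permutations, and there are ['C(n, #|A|)] of
    them. *)
Lemma card_perm_imset A B : #|A| = #|B| ->
  #|[set p : {perm 'I_n} | p @: A == B]| = (#|A|`! * (n - #|A|)`!)%N.
Proof.
pose N (C : {set 'I_n}) := #|[set p : {perm 'I_n} | p @: A == C]|.
have NE (C : {set 'I_n}) : #|A| = #|C| -> N C = N A.
  case/perm_imset_exists => u uA; rewrite /N -[RHS](card_imset _ (mulIg u)).
  apply: eq_card => p; rewrite [in LHS]inE; apply/eqP/imsetP => [pA | [v]]; last first.
    rewrite inE => /eqP vA ->; rewrite -uA -{2}vA -imset_comp.
    by apply: eq_imset => x; rewrite /= permM.
  exists (p * u^-1)%g; last by rewrite mulgKV.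
  rewrite inE (eq_imset (g := u^-1%g \o p)) => [|x]; last by rewrite /= permM.
  rewrite imset_comp pA -uA -imset_comp (eq_imset (g := id)) ?imset_id // => x.
  by rewrite /= permK.
move=> /NE; rewrite -/(N B) => ->; apply/eqP.
have le : (#|A| <= n)%N by rewrite -[X in (_ <= X)%N]card_ord max_card.
have C0 : (0 < 'C(n, #|A|))%N by rewrite bin_gt0.
rewrite -(eqn_pmul2l C0) bin_fact // -card_Sn -[X in _ == X]sum1_card.
rewrite (partition_big (fun p : {perm 'I_n} => p @: A) (fun C => #|C| == #|A|)) /=.
  rewrite (eq_bigr (fun=> N A)) => [|C /eqP cC].
    by rewrite sum_nat_const -cardsE card_draws card_ord.
  by rewrite -(NE C) // /N -sum1dep_card; apply: eq_bigl => p.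
by move=> p _; rewrite card_imset //; exact: perm_inj.
Qed.

End PermutationsBetweenSubsets.

(** * The induced characters as signed counts of fixed sets *)

Section HookCharacter.
Variables (F : fieldType) (n : nat).
Hypothesis charF0 : [pchar F] =i pred0.

(** The diagonal entry at Z of the signed permutation action of g on the functionals c_Z. *)
Definition set_char (g : W n) (Z : {set 'I_n}) : F :=
  if g.2 @: Z == Z then (\prod_(j in Z) bsign F (g.1 j)) * inv_sign F Z g.2 else 0.

Lemma bsignD a b : bsign F (a (+) b) = bsign F a * bsign F b.
Proof. by case: a; case: b; rewrite /bsign /= ?mulr1 ?mul1r ?mulrNN ?mulr1. Qed.

Lemma bsign_sqr a : bsign F a * bsign F a = 1.
Proof. by rewrite -bsignD addbb. Qed.

Lemma card_Z0 r : (r <= n)%N -> #|Z0 n r| = r.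
Proof.
move=> le; rewrite -sum1dep_card -(big_mkord (fun j => n - r <= j)%N (fun=> 1%N)) /=.
by rewrite -(big_nat_widenl _ _ _ predT) // sum_nat_const_nat muln1 subKn.
Qed.

(* The sets Z of cardinal r are the translates of Z0 r, i.e. the cosets of the
   stabiliser from which chi_hook is induced. *)
Lemma phi_hook_conj r (g x : W n) (c := mulW (invW x) (mulW g x)) :
  (if stabZ0 r c then phi_hook F r c else 0) = set_char g (x.2 @: Z0 n r).
Proof.
have c2 (A : {set 'I_n}) : c.2 @: A = x.2^-1%g @: (g.2 @: (x.2 @: A)).
  by rewrite -!imset_comp; apply: eq_imset => y; rewrite /= !permM.
have xK (A : {set 'I_n}) : x.2^-1%g @: (x.2 @: A) = A.
  by rewrite -imset_comp (eq_imset (g := id)) ?imset_id // => y; rewrite /= permK.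
set Z := x.2 @: _.
have stabE : stabZ0 r c = (g.2 @: Z == Z).
  by rewrite /stabZ0 c2 -{2}[Z0 n r]xK (inj_eq (imset_inj perm_inj)).
rewrite /set_char stabE; case: eqP => // gZ.
transitivity ((\prod_(j in Z0 n r) bsign F (c.1 j)) * inv_sign F (Z0 n r) c.2) => //.
have injx : {in Z0 n r &, injective x.2} by move=> ? ? _ _; apply: perm_inj.
congr (_ * _).
  have -> : \prod_(j in Z0 n r) bsign F (c.1 j) =
    \prod_(j in Z) (bsign F (x.1 j) * bsign F (g.1 j) * bsign F (x.1 (g.2^-1%g j))).
    rewrite big_imset //; apply: eq_bigr => j _.
    by rewrite !ffunE /= invgK !bsignD mulrA.
  (* As [g.2] preserves Z, both factors coming from [x.1] have the same product over Z, and their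
     product squares to 1. *)
  rewrite !big_split /= [X in _ * X](_ : _ = \prod_(j in Z) bsign F (x.1 j)).
    rewrite mulrAC -big_split big1 ?mul1r // => j _; exact: bsign_sqr.
  rewrite (reindex_inj (@perm_inj _ g.2)) /=.
  by apply: eq_big => [j|j _]; rewrite ?permK // -{1}gZ (mem_imset _ _ (@perm_inj _ g.2)).
have E : inv_sign F Z x.2^-1%g * inv_sign F (Z0 n r) x.2 = 1.
  by rewrite mulrC -inv_signM mulgV inv_sign1.
rewrite /c /= !inv_signM (_ : (x.2 * g.2)%g @: Z0 n r = Z) -/Z.
  by rewrite mulrC mulrA E mul1r.
rewrite -[RHS]gZ -imset_comp; apply: eq_imset => y; by rewrite /= permM.
Qed.

Lemma natr_char0_eq0 m : ((m%:R : F) == 0) = (m == 0).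
Proof. by have /pcharf0P := charF0. Qed.

(** Dimensions are computed as traces in F; this brings the resulting equalities back to [nat]. *)
Lemma natr_char0_inj : injective (fun m => m%:R : F).
Proof.
move=> a b /= E; wlog le : a b E / (a <= b)%N.
  by move=> H; case/orP: (leq_total a b) => ?; [|apply/esym]; apply: H.
by apply/eqP; rewrite eqn_leq le -subn_eq0 -natr_char0_eq0 natrB // E subrr eqxx.
Qed.

(** Grouping the x by the translate Z of [Z0 n r], each Z of size r is hit by 2^n (n-r)! r! of them,
    which cancels the normalisation. For r > n both sides are zero. *)
Lemma chi_hookE r (g : W n) : chi_hook F r g = \sum_(Z : {set 'I_n} | #|Z| == r) set_char g Z.
Proof.
rewrite /chi_hook; case: leqP => [le | lt]; last first.
  rewrite big_pred0 // => Z; apply: contraTF lt => /eqP <-.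
  by rewrite -leqNgt -[X in (_ <= X)%N]card_ord max_card.
rewrite big_mkcond /= (eq_bigr (fun x : W n => set_char g (x.2 @: Z0 n r))); last first.
  by move=> x _; rewrite -phi_hook_conj.
rewrite (partition_big (fun x : W n => x.2 @: Z0 n r) (fun Z => #|Z| == r)) /=; last first.
  by move=> x _; rewrite card_imset ?card_Z0 //; exact: perm_inj.
rewrite mulr_sumr; apply: eq_bigr => Z /eqP cZ.
rewrite (eq_bigr (fun=> set_char g Z)) => [|x /eqP -> //].
rewrite sumr_const (_ : #|_| = 2 ^ n * (n - r)`! * r`!)%N.
  rewrite -[set_char g Z *+ _]mulr_natl mulrA mulVf ?mul1r // natr_char0_eq0.
  by rewrite -lt0n !muln_gt0 expn_gt0 !fact_gt0.
have E : #|[set p : {perm 'I_n} | p @: Z0 n r == Z]| = (r`! * (n - r)`!)%N.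
  by rewrite card_perm_imset card_Z0.
rewrite -mulnA [(_`! * _)%N]mulnC -E.
have -> : (2 ^ n = #|{: {ffun 'I_n -> bool}}|)%N by rewrite card_ffun card_bool card_ord.
by rewrite -[RHS]cardX; apply: eq_card => x; rewrite !inE.
Qed.

End HookCharacter.

(** * Traces on subspaces cut out by the functionals c_Z *)

Section Traces.
Variables (F : fieldType) (n : nat).
Local Notation P := (Pn F n).

(** [epsilon] meets its specification once some subspace with the prescribed members is
    exhibited. *)
Lemma vspace_ofP (Q : P -> Prop) :
    (exists U : {vspace P}, forall v, v \in U <-> Q v) ->
  forall v, v \in vspace_of Q <-> Q v.
Proof. exact: epsilon_spec. Qed.

Definition Pn_basis (k : Idx n) : P := [ffun k' => (k' == k)%:R].

Lemma Pn_basisE (v : P) : v = \sum_k v k *: Pn_basis k.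
Proof.
apply/ffunP => k; rewrite sum_ffunE (bigD1 k) //= big1 ?addr0 => [|k' nk].
  by rewrite !ffunE eqxx [RHS]mulr1.
by rewrite !ffunE eq_sym (negbTE nk) [LHS]mulr0.
Qed.

(* If q projects onto U, the trace of h on U is that of h \o q on the whole space. *)
Lemma trace_on_projection (U : {vspace P}) (q h : {linear P -> P}) :
    (forall v, q v \in U) -> {in U, forall v, q v = v} ->
    {in U, forall v, h v \in U} ->
  trace_on U h = \sum_k h (q (Pn_basis k)) k.
Proof.
move=> qU qid hU; rewrite /trace_on.
have cE v i : v \in U ->
    coord (vbasis U) i v = \sum_k v k * coord (vbasis U) i (q (Pn_basis k)).
  move=> vU; rewrite -{1}[v]qid // {1}[v]Pn_basisE !linear_sum.
  by apply: eq_bigr => k _; rewrite !linearZ.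
under eq_bigr => i _ do rewrite cE ?hU ?vbasis_mem ?mem_tnth //.
rewrite exchange_big; apply: eq_bigr => k _ /=.
rewrite [in RHS](coord_vbasis (qU (Pn_basis k))) linear_sum sum_ffunE.
by apply: eq_bigr => i _; rewrite linearZ ffunE (tnth_nth 0) [RHS]mulrC.
Qed.

Definition vanishing (d : pred nat) (f : P) :=
  forall Z : {set 'I_n}, d #|Z| -> sorted_coef Z f = 0.

Lemma sorted_coef_is_linear Z : linear (sorted_coef Z : P -> F^o).
Proof.
move=> c u v; rewrite /sorted_coef scaler_sumr -big_split; apply: eq_bigr => p _.
by rewrite !ffunE /= mulrDr; congr (_ + _); rewrite mulrCA.
Qed.

HB.instance Definition _ Z :=
  GRing.isLinear.Build F P F^o *:%R (sorted_coef Z) (sorted_coef_is_linear Z).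

Lemma vanishing_vspace d : exists U : {vspace P}, forall v, v \in U <-> vanishing d v.
Proof.
pose phi (f : P) : {ffun {set 'I_n} -> F^o} :=
  [ffun Z : {set 'I_n} => if d #|Z| then sorted_coef Z f else 0].
have phiL : linear phi.
  move=> c u v; apply/ffunP => Z; rewrite !ffunE; case: ifP => _.
    exact: sorted_coef_is_linear.
  by rewrite scaler0 addr0.
pose phi_lin := GRing.isLinear.Build F P {ffun {set 'I_n} -> F^o} *:%R phi phiL.
pose phi' : {linear P -> {ffun {set 'I_n} -> F^o}} := HB.pack phi phi_lin.
exists (lker (linfun phi')) => v; rewrite memv_ker lfunE /=; split.
  by move=> /eqP/ffunP H Z dZ; move: (H Z); rewrite !ffunE dZ.
by move=> H; apply/eqP/ffunP => Z; rewrite !ffunE; case: ifP => // /H.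
Qed.

(** By duality of [sec_basis], the subtraction cancels exactly the coefficients c_Z at the levels in
    [d], giving a projection onto [vanishing d]. *)
Definition proj_vanishing (d : pred nat) (f : P) : P :=
  f - \sum_(Z : {set 'I_n} | d #|Z|) sorted_coef Z f *: sec_basis F Z.

Lemma proj_vanishing_is_linear d : linear (proj_vanishing d).
Proof.
move=> c u v; rewrite /proj_vanishing scalerBr addrACA -opprD; congr (_ - _).
rewrite scaler_sumr -big_split; apply: eq_bigr => Z _.
by rewrite sorted_coef_is_linear scalerDl scalerA.
Qed.

HB.instance Definition _ d :=
  GRing.isLinear.Build F P P *:%R (proj_vanishing d) (proj_vanishing_is_linear d).

Lemma trace_on_vanishing d (U : {vspace P}) (h : {linear P -> P}) :
    (forall v, v \in U <-> vanishing d v) -> {in U, forall v, h v \in U} ->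
  trace_on U h = \sum_k h (Pn_basis k) k -
    \sum_(Z : {set 'I_n} | d #|Z|) sorted_coef Z (h (sec_basis F Z)).
Proof.
move=> UE hU; rewrite (trace_on_projection (q := proj_vanishing d)) //=.
- under eq_bigr => k _.
    rewrite /proj_vanishing linearB linear_sum ffunE [X in _ + X]ffunE sum_ffunE; over.
  rewrite sumrB exchange_big; congr (_ - _); apply: eq_bigr => Z dZ /=.
  rewrite [h (sec_basis F Z) in RHS]Pn_basisE linear_sum.
  apply: eq_bigr => k _ /=.
  by rewrite !linearZ /= ffunE [LHS]mulrC.
- move=> v; apply/UE => Z dZ.
  rewrite /proj_vanishing linearB linear_sum /= (bigD1 Z) //= big1 => [|Z' /andP[_ nZ]].
    by rewrite linearZ /= sorted_coef_sec eqxx addr0 [X in _ - X]mulr1 subrr.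
  by rewrite linearZ /= sorted_coef_sec eq_sym (negbTE nZ) [LHS]mulr0.
- move=> v /UE van; rewrite /proj_vanishing big1 ?subr0 // => Z dZ.
  by rewrite van ?scale0r.
Qed.

End Traces.

(** * Identities and central polynomials as vanishing conditions *)

Section GradedPolynomials.
Variables (F : fieldType) (n : nat).

Lemma big_gmul_has0 t (I : eqType) (s : seq I) (w : I -> Gr F t) i :
  i \in s -> w i = 0 -> \big[@gmul F t/gone F t]_(j <- s) w j = 0.
Proof.
by case/splitPr => s1 s2 wi; rewrite big_cat big_cons wi /= gmul0g gmulg0.
Qed.

(** Even letters are sent to 1 outside Z and to 0 inside; odd letters to distinct generators inside
    Z and to 0 outside. A monomial with another odd set then contains a zero letter. *)
Lemma graded_assign_isolating t (Z : {set 'I_n}) : (0 < t)%N -> (#|Z| <= t)%N ->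
  exists (a b : 'I_n -> Gr F t) (c : F) (S : {set 'I_t}),
    [/\ graded_assign a b, c != 0, #|S| = #|Z| &
        forall f : Pn F n, poly_eval f a b = gscale (sorted_coef Z f * c) (gbasis F S)].
Proof.
case: t => // t _ leZ.
pose r (j : 'I_n) : 'I_t.+1 := inord (index j (enum Z)).
pose a (j : 'I_n) := if j \in Z then (0 : Gr F t.+1) else gone F t.+1.
pose b (j : 'I_n) := if j \in Z then gbasis F [set r j] else (0 : Gr F t.+1).
have ab : graded_assign a b.
  split=> j S oS; rewrite /a /b; case: ifP => _; rewrite !ffunE //.
    by case: eqP oS => // ->; rewrite cards0.
  by case: eqP oS => // ->; rewrite cards1.
pose s := [seq j <- enum 'I_n | j \in Z].
have us : uniq s by rewrite filter_uniq ?enum_uniq.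
have mem_s j : (j \in s) = (j \in Z) by rewrite mem_filter mem_enum andbT.
have injr : {in s &, injective r}.
  move=> i j; rewrite !mem_s => iZ jZ /(congr1 val) /=.
  have idx l : l \in Z -> (index l (enum Z) < t.+1)%N.
    by move=> lZ; rewrite (leq_trans _ leZ) // cardE index_mem mem_enum.
  rewrite !inordK ?idx // => E.
  by rewrite -(@nth_index _ i i (enum Z)) ?mem_enum // E nth_index ?mem_enum.
have [c c0 cE] := big_gmul_odd_basis F us injr.
exists a, b, c, [set x | x \in map r s]; split=> //.
  rewrite cardsE (card_uniqP _) ?map_inj_in_uniq // size_map.
  by rewrite -(card_uniqP us); apply: eq_card.
move=> f; apply/ffunP => S; rewrite poly_evalE // (bigD1 Z) //= big1 ?addr0; last first.
  move=> Z' nZ; have [j jZ] : exists j, (j \in Z') != (j \in Z).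
    apply/existsP; apply: contraNT nZ => /existsPn H.
    by apply/eqP/setP => j; apply/eqP; rewrite -[_ == _]negbK H.
  rewrite monomial_evalE (big_gmul_has0 (i := j)) ?mem_enum ?ffunE ?mulr0 //=.
  by move: jZ; rewrite perm1 /letter /a /b; case: (j \in Z'); case: (j \in Z).
rewrite monomial_evalE -gscaleA -cE [RHS]ffunE; congr (_ * _).
apply: (congr1 (fun u : Gr F t.+1 => u S)).
rewrite [RHS]big_filter [RHS]big_mkcond; apply: eq_bigr => j _.
rewrite perm1 /letter /a /b /=.
by case: (j \in Z).
Qed.

(** Isolating assignments detect every level up to t; beyond t, monomials vanish because their
    degree exceeds t. *)
Lemma identity_polyP t (f : Pn F n) : (0 < t)%N ->
  identity_poly t f <-> vanishing (fun m => m <= t)%N f.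
Proof.
move=> t0; split=> [idf Z leZ | van a b ab].
  have [a [b [c [S [ab c0 _ ev]]]]] := graded_assign_isolating t0 leZ.
  have /ffunP/(_ S)/eqP := idf a b ab; rewrite ev !ffunE eqxx mulr1 mulf_eq0 (negbTE c0).
  by rewrite orbF => /eqP.
apply/ffunP => S; rewrite poly_evalE // ffunE big1 // => Z _.
have [leZ | ltZ] := leqP #|Z| t; first by rewrite van ?mul0r.
apply/eqP; rewrite mulf_eq0; apply/orP; right; apply: contraTT ltZ.
move=> /(monomial_eval_supp (k := (Z, 1%g)) ab)[le _]; rewrite -leqNgt.
by apply: leq_trans le _; rewrite -[X in (_ <= X)%N]card_ord max_card.
Qed.

Lemma central_polyP t (f : Pn F n) : (2%:R : F) != 0 -> (0 < t)%N ->
  central_poly t f <-> vanishing (fun m => odd m && (m < t))%N f.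
Proof.
move=> char2 t0; split=> [cf Z /andP[oZ ltZ] | van a b ab x].
  have [a [b [c [S [ab c0 cS ev]]]]] := graded_assign_isolating t0 (ltnW ltZ).
  have := cf a b ab; rewrite ev => /gbasis_noncentral; rewrite cS => /(_ char2 oZ ltZ).
  by move/eqP; rewrite mulf_eq0 (negbTE c0) orbF => /eqP.
(* Centrality is the case [e = 0] of sign commutation: either A is even, or A must be the full set
   and then B is empty. *)
rewrite -[RHS]gscale1 -(expr0 (-1)); apply: gmul_comm_sign => A B dAB uA _.
rewrite oddM; case: (boolP (odd #|A|)) => //= oA.
suff AT : A = setT.
  by move: dAB; rewrite AT -setI_eq0 setTI => /eqP ->; rewrite cards0.
apply/eqP; rewrite eqEcard subsetT cardsT card_ord leqNgt; apply: contra uA => ltA.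
rewrite poly_evalE // big1 // => Z _; apply/eqP; rewrite mulf_eq0.
case: eqP => //= /eqP fZ; apply: contraNT fZ => /(monomial_eval_supp (k := (Z, 1%g)) ab).
by move=> /= [le oZ]; rewrite van // -oZ oA (leq_ltn_trans le).
Qed.

Lemma act_is_linear (g : W n) : linear (Defs.act g : Pn F n -> Pn F n).
Proof.
by move=> c u v; apply/ffunP => k; rewrite !ffunE mulrDr; congr (_ + _); exact: mulrCA.
Qed.

HB.instance Definition _ (g : W n) :=
  GRing.isLinear.Build F (Pn F n) (Pn F n) *:%R (Defs.act g) (act_is_linear g).

Lemma vanishing_act d (g : W n) (f : Pn F n) : vanishing d f -> vanishing d (Defs.act g f).
Proof.
move=> van Z dZ; rewrite sorted_coef_act van ?mulr0 // card_imset //; exact: perm_inj.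
Qed.

Lemma sorted_coef_act_sec (g : W n) Z :
  sorted_coef Z (Defs.act g (sec_basis F Z)) = set_char F g Z.
Proof.
rewrite sorted_coef_act sorted_coef_sec /set_char.
have -> : (g.2^-1%g @: Z == Z) = (g.2 @: Z == Z).
  rewrite -[LHS](inj_eq (imset_inj (@perm_inj _ g.2))) -imset_comp.
  rewrite (eq_imset (g := id)) ?imset_id 1?eq_sym // => y.
  by rewrite /= permKV.
case: eqP => [gZ|]; rewrite ?mulr0 // mulr1 -[in inv_sign _ _ _]gZ -imset_comp.
rewrite (eq_imset (g := id)) ?imset_id // => y; by rewrite /= permK.
Qed.

Lemma sum_levels (R : nmodType) (G : {set 'I_n} -> R) (d : pred nat) m1 m2 :
  \sum_(Z : {set 'I_n} | d #|Z| && (m1 <= #|Z| < m2)%N) G Z =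
  \sum_(m1 <= i < m2 | d i) \sum_(Z : {set 'I_n} | #|Z| == i) G Z.
Proof.
rewrite (exchange_big_dep predT) //= big_mkcond; apply: eq_bigr => Z _.
under [RHS]eq_bigl do rewrite eq_sym.
by rewrite (big_nat1_cond_eq _ (fun=> G Z)) andbC.
Qed.

Section VanishingSubspace.
Hypothesis charF0 : [pchar F] =i pred0.
Variables (d : pred nat) (m1 m2 : nat) (U : {vspace Pn F n}).
Hypothesis UE : forall v, v \in U <-> vanishing (fun m => d m && (m1 <= m < m2)%N) v.

(** The first sum, the trace on the whole space, is the same for all subspaces and cancels in the
    differences defining the characters. *)
Lemma trace_on_act (g : W n) :
  trace_on U (Defs.act g) =
    \sum_k Defs.act g (Pn_basis F k) k - \sum_(m1 <= i < m2 | d i) chi_hook F i g.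
Proof.
rewrite (trace_on_vanishing UE) => [|v /UE van]; last by apply/UE/vanishing_act.
congr (_ - _); under [RHS]eq_bigr do rewrite (chi_hookE charF0).
by rewrite -sum_levels; apply: eq_bigr => Z _; exact: sorted_coef_act_sec.
Qed.

(** The trace formula at the identity, with one unit per set Z. The additive form avoids truncated
    subtraction. *)
Lemma dim_vanishing : (\dim U + \sum_(m1 <= i < m2 | d i) 'C(n, i) = #|{: Idx n}|)%N.
Proof.
apply: (natr_char0_inj charF0).
have : trace_on U (idfun : Pn F n -> Pn F n) = (\dim U)%:R.
  rewrite /trace_on (eq_bigr (fun=> 1)) ?sumr_const ?card_ord // => i _.
  by rewrite (tnth_nth 0) coord_free ?eqxx ?(basis_free (vbasisP U)).
rewrite (trace_on_vanishing UE) // natrD => <-.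
rewrite (eq_bigr (fun=> 1)) => [|k _]; last by rewrite ffunE eqxx.
rewrite sumr_const [X in _ - X](eq_bigr (fun=> 1)) => [|Z _]; last first.
  by rewrite sorted_coef_sec eqxx.
rewrite sum_levels natr_sum -addrA [X in _ + X](_ : _ = 0) ?addr0 //.
apply/eqP; rewrite addrC subr_eq0; apply/eqP; apply: eq_bigr => i _.
by rewrite sumr_const; have := card_draws 'I_n i; rewrite card_ord cardsE => <-.
Qed.

End VanishingSubspace.

End GradedPolynomials.

(** * The cases t = 2k and t = 2k+1 *)

Lemma eq_vanishing F n (d d' : pred nat) (f : Pn F n) :
  d =1 d' -> vanishing d f <-> vanishing d' f.
Proof. by move=> dd; split=> van Z dZ; apply: van; rewrite ?dd // -dd. Qed.

Lemma mem_PId (F : fieldType) n t (f : Pn F n) : (0 < t)%N ->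
  f \in PId F n t <-> vanishing (fun m => predT m && (0 <= m < t.+1)%N) f.
Proof.
move=> t0; rewrite -(identity_polyP _ t0); apply: vspace_ofP.
have [U UE] := vanishing_vspace F n (fun m => m <= t)%N.
by exists U => v; rewrite UE identity_polyP.
Qed.

Lemma mem_PC (F : fieldType) n k t (f : Pn F n) : (2%:R : F) != 0 ->
    (0 < t)%N -> t./2 = k ->
  f \in PC F n t <-> vanishing (fun m => odd m && (1 <= m < k.*2.+1)%N) f.
Proof.
move=> char2 t0 tk; rewrite (@eq_vanishing _ _ _ (fun m => odd m && (m < t))%N).
  rewrite -(central_polyP _ char2 t0); apply: vspace_ofP.
  have [U UE] := vanishing_vspace F n (fun m => odd m && (m < t))%N.
  by exists U => v; rewrite UE central_polyP.
move=> m; case: (boolP (odd m)) => //= om.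
(* With m odd, both bounds amount to comparing the halves of m and t, so t = 2k and t = 2k+1 give
   the same levels. *)
rewrite odd_gt0 // ltnS -tk -{1}(odd_double_half m) -[X in _ = (_ < X)%N]odd_double_half.
rewrite -[in RHS](odd_double_half m) om !add1n ltn_double.
by case: (odd t); rewrite ?add1n ?ltnS ?add0n ?ltn_double ?ltn_Sdouble.
Qed.

Theorem theorem5p4 (F : fieldType) (charF0 : [pchar F] =i pred0)
    (k n : nat) (k_ge1 : (1 <= k)%N) (n_ge1 : (1 <= n)%N) :
  [/\ (* (1) *)
      cgrz F n k.*2 = (\sum_(1 <= i < k.*2.+1 | odd i) 'C(n, i))%N /\
      cgrz F n k.*2.+1 = (\sum_(1 <= i < k.*2.+1 | odd i) 'C(n, i))%N,
      (* (2) *)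
      deltagr F n k.*2 = (\sum_(0 <= i < k.*2.+1 | ~~ odd i) 'C(n, i))%N /\
      deltagr F n k.*2.+1 = ('C(n, k.*2.+1) + deltagr F n k.*2)%N,
      (* (3) *)
      (forall g : W n, chigrz F k.*2 g = \sum_(1 <= i < k.*2.+1 | odd i) chi_hook F i g /\
                       chigrz F k.*2.+1 g = \sum_(1 <= i < k.*2.+1 | odd i) chi_hook F i g) &
      (* (4) *)
      (forall g : W n,
         chiDelta F k.*2 g = \sum_(0 <= i < k.*2.+1 | ~~ odd i) chi_hook F i g /\
         chiDelta F k.*2.+1 g = chi_hook F k.*2.+1 g +
                                \sum_(0 <= i < k.*2.+1 | ~~ odd i) chi_hook F i g)].
Proof.
have char2 : (2%:R : F) != 0 by rewrite natr_char0_eq0.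
have t0 : (0 < k.*2)%N by rewrite double_gt0.
have PC_even (f : Pn F n) := mem_PC f char2 t0 (doubleK k).
have PC_odd (f : Pn F n) := mem_PC f char2 (ltn0Sn k.*2) (uphalf_double k).
have PId_even (f : Pn F n) := mem_PId f t0.
have PId_odd (f : Pn F n) := mem_PId f (ltn0Sn k.*2).
(* The empty range of levels presents the whole space as a vanishing subspace, so the same formulas
   apply to it. *)
have full f : f \in (fullv : {vspace Pn F n}) <->
    vanishing (fun m => predT m && (0 <= m < 0)%N) f.
  by rewrite memvf; split=> // _ Z; rewrite andbF.
(* Odd levels may start at 1 since level 0 is even; they are the ones shared with the central
   polynomials. *)
have levels (R : nmodType) (L : nat -> R) :
    \sum_(0 <= i < k.*2.+1 | predT i) L i =
    \sum_(1 <= i < k.*2.+1 | odd i) L i + \sum_(0 <= i < k.*2.+1 | ~~ odd i) L i.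
  rewrite (bigID odd) /=; congr (_ + _).
  by rewrite [LHS]big_mkcond big_ltn //= add0r -big_mkcond.
have levelsS (R : nmodType) (L : nat -> R) :
    \sum_(0 <= i < k.*2.+2 | predT i) L i = \sum_(0 <= i < k.*2.+1 | predT i) L i + L k.*2.+1.
  by rewrite big_nat_recr.
have dimPC_even := dim_vanishing charF0 PC_even.
have dimPC_odd := dim_vanishing charF0 PC_odd.
have := dim_vanishing charF0 PId_even; rewrite (levels nat) => dimPId_even.
have := dim_vanishing charF0 PId_odd; rewrite (levelsS nat) (levels nat) => dimPId_odd.
have := dim_vanishing charF0 full; rewrite big_geq // addn0 => dim_full.
move: dimPC_even dimPC_odd dimPId_even dimPId_odd dim_full; rewrite /cgrz /deltagr.
set odds := (\sum_(1 <= i < _ | odd i) _)%N; set evens := (\sum_(0 <= i < _ | _) _)%N.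
move=> dPC_even dPC_odd dPId_even dPId_odd d_full.
split.
- lia.
- lia.
- move=> g; rewrite /chigrz (trace_on_act charF0 full) big_geq // subr0.
  rewrite (trace_on_act charF0 PC_even) (trace_on_act charF0 PC_odd).
  by split; ring.
move=> g; rewrite /chiDelta (trace_on_act charF0 PC_even) (trace_on_act charF0 PC_odd).
rewrite (trace_on_act charF0 PId_even) (trace_on_act charF0 PId_odd) levelsS levels.
by split; ring.
Qed.
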